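(* Let $K$ be a field and let $M$ be the Chinese monoid of rank $n\ge 1$. Then the prime radical of the Chinese algebra $K[M]$ is equal to its Jacobson radical.
   Context: The Chinese monoid of rank $n$ is the monoid $M=\langle a_1,\dots,a_n\rangle$ defined by the relations $a_ja_ia_k=a_ja_ka_i=a_ka_ja_i$ for $i\le k\le j$; the Chinese algebra $K[M]$ is its monoid algebra over $K$. *)

(* Defs.v *)
From HB Require Import structures.
From mathcomp Require Import all_boot all_algebra generic_quotient.
From mathcomp Require Import boolp classical_sets.
From mathcomp.multinomials Require Import monalg.

Set Implicit Arguments.
Unset Strict Implicit.
Unset Printing Implicit Defensive.

Import GRing.Theory.

(* The generators a_1, ..., a_n are indexed by 'I_n, i.e. by 0, ..., n.-1;
   a word in the generators is the list of its indices. *)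
Inductive chinese_relation (n : nat) : seq 'I_n -> seq 'I_n -> Prop :=
| ChineseRelation1 (i k j : 'I_n) : (i <= k)%N -> (k <= j)%N ->
    chinese_relation [:: j; i; k] [:: j; k; i]
| ChineseRelation2 (i k j : 'I_n) : (i <= k)%N -> (k <= j)%N ->
    chinese_relation [:: j; k; i] [:: k; j; i].

Inductive congruence_closure (T : Type) (r : seq T -> seq T -> Prop) :
    seq T -> seq T -> Prop :=
| CongruenceBase u v : r u v -> congruence_closure r u v
| CongruenceRefl u : congruence_closure r u u
| CongruenceSym u v : congruence_closure r u v -> congruence_closure r v u
| CongruenceTrans v u w : congruence_closure r u v ->
    congruence_closure r v w -> congruence_closure r u w
| CongruenceCat u u' v v' : congruence_closure r u u' ->
    congruence_closure r v v' -> congruence_closure r (u ++ v) (u' ++ v').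

Definition chinese_congruence (n : nat) : rel (seq 'I_n) :=
  fun u v => `[< congruence_closure (@chinese_relation n) u v >].

Lemma chinese_congruence_equiv (n : nat) :
  equiv_class_of (@chinese_congruence n).
Proof.
split=> [u|u v|v u w].
- by apply/asboolP; exact: CongruenceRefl.
- by apply/asboolP/asboolP; exact: CongruenceSym.
- move=> /asboolP uv /asboolP vw; apply/asboolP.
  exact: CongruenceTrans uv vw.
Qed.

Canonical chinese_equiv (n : nat) :=
  EquivRelPack (chinese_congruence_equiv n).

Local Open Scope quotient_scope.

Definition chinese_monoid (n : nat) : Type :=
  {eq_quot (chinese_equiv n)}.

HB.instance Definition _ (n : nat) := Choice.on (chinese_monoid n).
HB.instance Definition _ (n : nat) :=
  EqQuotient.copy (chinese_monoid n) {eq_quot (chinese_equiv n)}.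

Section ChineseMonoid.
Variable n : nat.
Implicit Types x y z : chinese_monoid n.

Definition chinese_class (u : seq 'I_n) : chinese_monoid n :=
  \pi_(chinese_monoid n) u.

Lemma chinese_classP (u v : seq 'I_n) :
  chinese_class u = chinese_class v <->
  congruence_closure (@chinese_relation n) u v.
Proof.
split=> [/eqquotP /asboolP //|uv].
by apply/eqquotP/asboolP.
Qed.

Lemma chinese_class_repr x : chinese_class (repr x) = x.
Proof. exact: reprK. Qed.

Definition chinese_one : chinese_monoid n := chinese_class [::].

Definition chinese_mul x y : chinese_monoid n :=
  chinese_class (repr x ++ repr y).

Lemma chinese_classM (u v : seq 'I_n) :
  chinese_mul (chinese_class u) (chinese_class v) = chinese_class (u ++ v).
Proof.
by apply/chinese_classP/CongruenceCat;
  apply/chinese_classP; rewrite chinese_class_repr.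
Qed.

Lemma chinese_mulA : associative chinese_mul.
Proof.
move=> x y z; rewrite -[x]chinese_class_repr -[y]chinese_class_repr.
by rewrite -[z]chinese_class_repr !chinese_classM catA.
Qed.

Lemma chinese_mul1m : left_id chinese_one chinese_mul.
Proof. by move=> x; rewrite -[x]chinese_class_repr chinese_classM. Qed.

Lemma chinese_mulm1 : right_id chinese_one chinese_mul.
Proof. by move=> x; rewrite -[x]chinese_class_repr chinese_classM cats0. Qed.

Lemma chinese_size (u v : seq 'I_n) :
  congruence_closure (@chinese_relation n) u v -> size u = size v.
Proof.
elim=> {u v} [u v []|//|u v _ ->//|v u w _ -> _ ->//|u u' v v' _ + _ +] //.
by rewrite !size_cat => -> ->.
Qed.

Lemma chinese_unitm x y :
  chinese_mul x y = chinese_one -> x = chinese_one /\ y = chinese_one.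
Proof.
rewrite -[x]chinese_class_repr -[y]chinese_class_repr chinese_classM.
move=> /chinese_classP/chinese_size/eqP; rewrite size_cat addn_eq0.
by move=> /andP[/nilP -> /nilP ->].
Qed.

HB.instance Definition _ := Choice_isMonomialDef.Build (chinese_monoid n)
  chinese_mulA chinese_mul1m chinese_mulm1 chinese_unitm.

End ChineseMonoid.

Section Radicals.
Local Open Scope ring_scope.
Local Open Scope classical_set_scope.
Variable R : nzRingType.
Implicit Types I J P : set R.

Record left_ideal I : Prop := LeftIdeal {
  left_ideal0 : I 0;
  left_idealB : forall x y, I x -> I y -> I (x - y);
  left_idealM : forall a x, I x -> I (a * x)
}.

Record two_sided_ideal I : Prop := TwoSidedIdeal {
  two_sided_ideal_left : left_ideal I;
  two_sided_idealMr : forall x a, I x -> I (x * a)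
}.

Definition ideal_product I J : set R :=
  [set x | exists s : seq (R * R),
    (forall p, p \in s -> I p.1 /\ J p.2) /\ x = \sum_(p <- s) p.1 * p.2].

(* [prime_idealr] from ring_quotient is not used: its elementwise condition
   x * y \in P -> x \in P \/ y \in P defines the completely prime ideals, in
   general a strictly smaller class when R is not commutative. *)
Record prime_ideal P : Prop := PrimeIdeal {
  prime_ideal_ideal : two_sided_ideal P;
  prime_ideal_proper : P <> setT;
  prime_idealP : forall I J, two_sided_ideal I -> two_sided_ideal J ->
    ideal_product I J `<=` P -> I `<=` P \/ J `<=` P
}.

Record maximal_left_ideal I : Prop := MaximalLeftIdeal {
  maximal_left_ideal_left : left_ideal I;
  maximal_left_ideal_proper : I <> setT;
  maximal_left_idealP : forall J, left_ideal J -> I `<=` J ->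
    J = I \/ J = setT
}.

Definition prime_radical : set R := \bigcap_(P in prime_ideal) P.

Definition jacobson_radical : set R := \bigcap_(I in maximal_left_ideal) I.

End Radicals.

Arguments prime_radical : clear implicits.
Arguments jacobson_radical : clear implicits.

(* Main.v *)
(* The bicyclic monoid is B = <p, q | qp = 1>.  For s < t, sending a_i to p if
   i <= s, to q if i >= t and to 1 otherwise extends to a homomorphism
   phi_{s,t} : M -> B, and together with the content of a word these
   homomorphisms separate the elements of M.  For a set A of pairs let I_A be
   the ideal spanned by the x - y with x, y of equal content and equal images
   under phi_a for all a in A.
   If a < b in A for the product order, then I_{A\b} I_{A\a} is contained in
   I_A; as I_A = 0 for the set of all pairs, every prime ideal contains I_A for
   some antichain A.  Conversely, if A is an antichain (a chain of strictly
   nested intervals), the image of M in B^A x Z^n contains, up to central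
   factors, each copy of p and q.  Hence K[M] acts on K[X][N^A] with matrix
   units up to powers of X, and if f is not in I_A there is g in K[M] such that
   g f has an eigenvector whose eigenvalue is a nonconstant polynomial; then
   1 - g f is not invertible, so f is not in the Jacobson radical. *)

Require Import Defs.
From mathcomp Require Import all_boot all_algebra.
From mathcomp Require Import finmap.
From mathcomp Require Import boolp classical_sets.
From mathcomp.multinomials Require Import monalg.
From mathcomp Require Import zify.

Set Implicit Arguments.
Unset Strict Implicit.
Unset Printing Implicit Defensive.

Import GRing.Theory.

(** * Words and the bicyclic invariants *)

(** By $qp=1$ the inner factor $q^jp^k$ collapses to $p^{k-j}$ or $q^{j-k}$; truncated subtraction
    covers both cases. *)
Definition bicyclic_mul (x y : nat * nat) : nat * nat :=
  (x.1 + (y.1 - x.2), (x.2 - y.1) + y.2).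

Lemma bicyclic_mulA : associative bicyclic_mul.
Proof.
by move=> [i j] [i' j'] [k l]; rewrite /bicyclic_mul /=; congr (_, _); lia.
Qed.

Lemma bicyclic_mul1m : left_id (0, 0) bicyclic_mul.
Proof. by move=> [i j]; rewrite /bicyclic_mul /= subn0. Qed.

Lemma bicyclic_mulm1 : right_id (0, 0) bicyclic_mul.
Proof. by move=> [i j]; rewrite /bicyclic_mul /= sub0n subn0 !addn0. Qed.

Definition bicyclic_letter (s t k : nat) : nat * nat :=
  if k <= s then (1, 0) else if t <= k then (0, 1) else (0, 0).

Section Words.
Variable n : nat.
Implicit Types (u v w L : seq 'I_n) (i j k m c : 'I_n) (s t : nat).

(* The pair (i, j) stands for p^i q^j in the bicyclic monoid <p, q | qp = 1>;
   the first s.+1 generators act as p, those from t on as q, the others as 1. *)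
Definition word_bicyclic s t w : nat * nat :=
  foldr (fun k => bicyclic_mul (bicyclic_letter s t k)) (0, 0) w.

Lemma word_bicyclic_cat s t u v : word_bicyclic s t (u ++ v) =
  bicyclic_mul (word_bicyclic s t u) (word_bicyclic s t v).
Proof.
elim: u => [|a u IH] /=; first by rewrite bicyclic_mul1m.
by rewrite IH bicyclic_mulA.
Qed.

Lemma chinese_invariants u v : congruence_closure (@chinese_relation n) u v ->
  perm_eq u v /\
  forall s t, s < t -> word_bicyclic s t u = word_bicyclic s t v.
Proof.
elim=> {u v} [u v|u|u v _ [p e]|u v w _ [p e] _ [p' e']|u u' v v' _ [p e] _ [p' e']].
- case=> i k j ik kj; split=> [|s t st].
  + by apply/permP => a /=; rewrite !addn0; congr (_ + _); rewrite addnC.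
  + rewrite /= /bicyclic_letter; case: (leqP i s); case: (leqP k s);
    case: (leqP j s); case: (leqP t i); case: (leqP t k); case: (leqP t j);
    move=> *; by [|lia].
  + by apply/permP => a /=; rewrite addnCA.
  + rewrite /= /bicyclic_letter; case: (leqP i s); case: (leqP k s);
    case: (leqP j s); case: (leqP t i); case: (leqP t k); case: (leqP t j);
    move=> *; by [|lia].
- by [].
- by split=> [|s t st]; [rewrite perm_sym | rewrite e].
- by split=> [|s t st]; [exact: perm_trans p p' | rewrite e // e'].
- by split=> [|s t st]; [exact: perm_cat | rewrite !word_bicyclic_cat e // e'].
Qed.

(** Cancelling $qp$ preserves the difference of the exponents of $p$ and $q$, which the content
    therefore determines; the additive form avoids truncated subtraction. *)
Lemma word_bicyclic_count s t w : s < t ->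
  (word_bicyclic s t w).1 + count (fun k : 'I_n => t <= k) w =
  (word_bicyclic s t w).2 + count (fun k : 'I_n => k <= s) w.
Proof.
move=> st; elim: w => //= k w; rewrite /bicyclic_mul /bicyclic_letter.
by case: (leqP k s); case: (leqP t k) => /= *; lia.
Qed.

Lemma word_bicyclic_balance s t u v : s < t -> perm_eq u v ->
  (word_bicyclic s t u).1 + (word_bicyclic s t v).2 =
  (word_bicyclic s t v).1 + (word_bicyclic s t u).2.
Proof.
move=> st /permP uv; have := word_bicyclic_count u st.
have := word_bicyclic_count v st; rewrite !uv.
by case: (word_bicyclic s t u) (word_bicyclic s t v) => ? ? [? ?] /=; lia.
Qed.

(** Enlarging [s] and [t] only moves the images of letters in the direction $q\to 1\to p$. *)
Lemma word_bicyclic_mono s t s' t' w : s <= s' -> t <= t' -> s < t -> s' < t' ->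
  (word_bicyclic s t w).1 <= (word_bicyclic s' t' w).1 /\
  (word_bicyclic s' t' w).2 <= (word_bicyclic s t w).2.
Proof.
move=> ss tt st st'; elim: w => //= k w; rewrite /bicyclic_mul /bicyclic_letter.
case: (leqP k s); case: (leqP t k); case: (leqP k s'); case: (leqP t' k);
  rewrite /=; lia.
Qed.

Lemma word_bicyclic_small s t w : s < t -> all (fun k : 'I_n => k < t) w ->
  word_bicyclic s t w = (count (fun k : 'I_n => k <= s) w, 0).
Proof.
move=> st; elim: w => //= k w IH /andP[kt /IH ->].
rewrite /bicyclic_mul /bicyclic_letter [t <= k]leqNgt kt /=.
by case: leqP => _ /=; congr (_, _); lia.
Qed.

(** * Normal forms of words and completeness of the invariants *)

Local Notation cong := (congruence_closure (@chinese_relation n)).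

Lemma cong_catl w u v : cong u v -> cong (w ++ u) (w ++ v).
Proof. by apply: CongruenceCat; exact: CongruenceRefl. Qed.

Lemma cong_catr w u v : cong u v -> cong (u ++ w) (v ++ w).
Proof. by move=> uv; apply: CongruenceCat => //; exact: CongruenceRefl. Qed.

Lemma cong_jik_jki i k j : i <= k -> k <= j -> cong [:: j; i; k] [:: j; k; i].
Proof. by move=> ik kj; exact/CongruenceBase/ChineseRelation1. Qed.

Lemma cong_jki_kji i k j : i <= k -> k <= j -> cong [:: j; k; i] [:: k; j; i].
Proof. by move=> ik kj; exact/CongruenceBase/ChineseRelation2. Qed.

Lemma cong_swap c i m : i <= c -> m <= c -> cong [:: c; i; m] [:: c; m; i].
Proof.
move=> ic mc; case: (leqP i m) => im; first exact: cong_jik_jki.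
exact/CongruenceSym/cong_jik_jki/ic/ltnW.
Qed.

(** The larger of [i] and [m] can be pulled to the left of [c], the smaller one staying behind. *)
Lemma cong_pair_letter c i m : i <= c -> m <= c ->
  exists m' i', [/\ m' \in [:: i; m], i' \in [:: i; m] &
    cong [:: c; i; m] [:: m'; c; i']].
Proof.
move=> ic mc; case: (leqP i m) => im; last first.
  exists i, m; rewrite !inE !eqxx orbT; split=> //.
  apply: CongruenceTrans (cong_swap ic mc) _.
  apply: CongruenceTrans (CongruenceSym (cong_swap ic mc)) _.
  apply: CongruenceTrans (cong_swap ic mc) _.
  have := cong_jki_kji (ltnW im) ic; apply: CongruenceTrans.
  exact/CongruenceSym/cong_swap.
exists m, i; rewrite !inE !eqxx orbT; split=> //.
apply: CongruenceTrans (cong_swap ic mc) _.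
exact: cong_jki_kji.
Qed.

Definition pairs c L : seq 'I_n := flatten [seq [:: c; i] | i <- L].

Lemma pairs_cat c L L' : pairs c (L ++ L') = pairs c L ++ pairs c L'.
Proof. by rewrite /pairs map_cat flatten_cat. Qed.

(** By [cong_pair_letter] a small letter crosses the blocks from right to left, possibly trading
    places with the partner of [c] in each block. *)
Lemma cong_pairs_letter c L m : all (fun i => i < c) L -> m < c ->
  exists m' L', [/\ m' < c, all (fun i => i < c) L' &
    cong (pairs c L ++ [:: m]) (m' :: pairs c L')].
Proof.
elim/last_ind: L m => [|L i IH] m.
  by exists m, [::]; split=> //; exact: CongruenceRefl.
rewrite all_rcons => /andP[ic Lc] mc.
have [a [b [ain bin cab]]] := cong_pair_letter (ltnW ic) (ltnW mc).
have ac : a < c by move: ain; rewrite !inE => /orP[] /eqP ->.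
have bc : b < c by move: bin; rewrite !inE => /orP[] /eqP ->.
have [m' [L' [m'c L'c cc]]] := IH a Lc ac.
exists m', (rcons L' b); split=> //; first by rewrite all_rcons bc.
rewrite -!cats1 !pairs_cat -catA /=.
apply: CongruenceTrans (cong_catl _ cab) _.
by rewrite -[[:: a; c; b]]/([:: a] ++ [:: c; b]) catA; exact: (cong_catr [:: c; b] cc).
Qed.

(** Once both copies of [c] stand in front, [i] and [m] can be swapped. *)
Lemma cong_pair_pair c i m : i <= c -> m <= c ->
  cong [:: c; i; c; m] [:: c; m; c; i].
Proof.
move=> ic mc.
apply: CongruenceTrans (cong_catr [:: m] (cong_swap ic (leqnn c))) _.
apply: CongruenceTrans (cong_catl [:: c] (cong_swap ic mc)) _.
exact: CongruenceSym (cong_catr [:: i] (cong_swap mc (leqnn c))).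
Qed.

Lemma cong_pairs_pair c L m : all (fun i => i <= c) L -> m <= c ->
  cong (pairs c L ++ [:: c; m]) ([:: c; m] ++ pairs c L).
Proof.
move=> + mc; elim: L => [|i L IH] => [_|/= /andP[ic Lc]]; first exact: CongruenceRefl.
apply: CongruenceTrans (cong_catl [:: c; i] (IH Lc)) _.
exact: (cong_catr (pairs c L) (cong_pair_pair ic mc)).
Qed.

Lemma cong_pairs_perm c L L' : all (fun i => i <= c) L -> perm_eq L L' ->
  cong (pairs c L) (pairs c L').
Proof.
elim: L L' => [|i L IH] L' => [_|/= /andP[ic Lc]] LL'.
  by move: LL'; rewrite perm_sym => /perm_nilP ->; exact: CongruenceRefl.
have iL' : i \in L' by rewrite -(perm_mem LL') mem_head.
have/all_filterP {}Lc' : all (fun i => i <= c) L' by rewrite -(perm_all _ LL') /= ic.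
move: LL' Lc'; case/splitPr: iL' => L1 L2 LL' /all_filterP.
rewrite all_cat => /andP[L1c _].
rewrite pairs_cat -[pairs c (i :: L2)]/([:: c; i] ++ pairs c L2) catA.
apply: CongruenceSym; apply: CongruenceTrans (cong_catr _ (cong_pairs_pair L1c ic)) _.
rewrite -catA -pairs_cat -[pairs c (i :: L)]/([:: c; i] ++ pairs c L).
apply/cong_catl/CongruenceSym/IH => //.
by rewrite -(perm_cons i) (perm_trans LL') // -[i :: L2]cat1s perm_catCA.
Qed.

(** Induction on the last letter [m]. If [m] is [c], the final power grows. If [m] is smaller and
    that power is empty, [m] crosses the blocks and a letter joins [u]; otherwise $c^{k+1}m=(cm)c^k$
    creates a new block. *)
Lemma cong_normal c w : all (fun i => i <= c) w ->
  exists u L (l : nat), [/\ all (fun i => i < c) u, all (fun i => i < c) L &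
    cong w (u ++ pairs c L ++ nseq l c)].
Proof.
elim/last_ind: w => [|w m IH].
  by exists [::], [::], 0; split=> //; exact: CongruenceRefl.
rewrite all_rcons => /andP[mc /IH [u [L [k [uc Lc cw]]]]].
rewrite -cats1; move: (mc); rewrite leq_eqVlt => /orP[/eqP/val_inj -> | {}mc].
  exists u, L, k.+1; split=> //; rewrite -addn1 nseqD.
  by have := cong_catr [:: c] cw; rewrite -!catA.
case: k cw => [|k] cw.
  have [m' [L' [m'c L'c cm]]] := cong_pairs_letter Lc mc.
  exists (rcons u m'), L', 0; split=> //; first by rewrite all_rcons m'c.
  rewrite cats0 -cats1 -catA; apply: CongruenceTrans (cong_catr [:: m] cw) _.
  by rewrite cats0 -catA; exact: cong_catl.
exists u, (rcons L m), k; split=> //; first by rewrite all_rcons mc.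
apply: CongruenceTrans (cong_catr [:: m] cw) _.
rewrite -!catA -(cats1 L) pairs_cat -!catA; do 2!apply: cong_catl.
have cm : cong [:: c; c; m] [:: c; m; c] by exact: cong_swap (leqnn c) (ltnW mc).
elim: k {cw} => [|k IHk]; first exact: CongruenceRefl.
apply: CongruenceTrans (cong_catl [:: c] IHk) _.
exact: (cong_catr (nseq k c) cm).
Qed.

(** Here [c] acts as $q$, so a block acts as $qp=1$, $q$ or $q^2$, and no $p$ survives. *)
Lemma word_bicyclic_pairs1 s t c L : s < t -> t <= c ->
  all (fun i => i < c) L -> forall l : nat,
  (word_bicyclic s t (pairs c L ++ nseq l c)).1 = 0.
Proof.
move=> st tc Lc k; elim: L Lc => [_|i L IH /= /andP[ic /IH]].
  elim: k => //= k; rewrite /bicyclic_mul /bicyclic_letter => ->.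
  by rewrite leqNgt (leq_trans st tc) /= tc.
rewrite /bicyclic_mul /bicyclic_letter => ->.
rewrite [c <= s]leqNgt (leq_trans st tc) /= tc.
by case: leqP => //= _; case: leqP.
Qed.

Lemma perm_eq_count_leq L L' c : all (fun i => i < c) L -> all (fun i => i < c) L' ->
  (forall s : nat, s < c -> count (fun i => i <= s) L = count (fun i => i <= s) L') ->
  perm_eq L L'.
Proof.
move=> Lc L'c e; apply/allP => x _ /=; apply/eqP.
case: (ltnP x c) => xc; last first.
  have z K : all (fun i => i < c) K -> count_mem x K = 0.
    move=> /allP Kc; apply/count_memPn/negP => /Kc; by rewrite ltnNge xc.
  by rewrite !z.
have split_count K : count (fun i => i <= x) K =
    count (fun i : 'I_n => i < x) K + count_mem x K.
  elim: K => //= i K ->; rewrite -val_eqE /=; case: (ltngtP i x) => /= _; lia.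
have := e x xc; rewrite !split_count.
suff -> : count (fun i : 'I_n => i < x) L = count (fun i : 'I_n => i < x) L' by move/addnI.
case: (x : nat) xc => [|y] yc; first by rewrite !(@eq_count _ _ pred0) ?count_pred0.
exact/e/ltnW.
Qed.

(** Induction on the bound: the invariants determine the blocks and the final power in the normal
    form for the largest letter, and the rest uses smaller letters only. *)
Lemma chinese_complete_bounded d u v :
  all (fun i => i < d) u -> all (fun i => i < d) v -> perm_eq u v ->
  (forall s t, s < t -> t < n -> word_bicyclic s t u = word_bicyclic s t v) ->
  cong u v.
Proof.
elim: d u v => [|d IH] u v.
  by case: u v => [|x u] [|y v] // _ _ _ _; exact: CongruenceRefl.
case: (ltnP d n) => [dn|nd] ud vd uv e; last first.
  have small w : all (fun i : 'I_n => i < d) w.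
    by apply/allP => i _; exact: leq_trans (ltn_ord i) nd.
  by apply: IH.
set c := Ordinal dn.
have [u' [L [k [u'c Lc cu]]]] := @cong_normal c u ud.
have [v' [L' [k' [v'c L'c cv]]]] := @cong_normal c v vd.
have [pu eu] := chinese_invariants cu; have [pv ev] := chinese_invariants cv.
have puv : perm_eq (u' ++ pairs c L ++ nseq k c) (v' ++ pairs c L' ++ nseq k' c).
  by rewrite -(permPl pu) (permPl uv).
(* The tail of the normal form acts as a power of $q$, so the exponent of $p$ of the whole word is
   that of its front part. *)
have e1 s t : s < t -> t <= c ->
    (word_bicyclic s t u').1 = (word_bicyclic s t v').1.
  move=> st tc; have := e s t st (leq_ltn_trans tc dn); rewrite eu // ev //.
  rewrite [LHS]word_bicyclic_cat [RHS]word_bicyclic_cat => /(congr1 fst) /=.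
  by rewrite !word_bicyclic_pairs1 // !sub0n !addn0.
have countc s (K : seq 'I_n) l : s < c ->
    count (fun i : 'I_n => i <= s) (pairs c K ++ nseq l c) =
    count (fun i : 'I_n => i <= s) K.
  move=> sc; rewrite count_cat count_nseq leqNgt sc /= mul0n addn0.
  by elim: K => //= i K ->; rewrite [d <= s]leqNgt sc.
(* For $t=c$ no letter of [u'] acts as $q$, so the exponent of $p$ counts the letters of [u'] up to
   [s]. Subtracting this from the content gives the same count for [L]. *)
have pL : perm_eq L L'.
  apply: (perm_eq_count_leq Lc L'c) => s sc.
  have := e1 s c sc (leqnn c); rewrite !word_bicyclic_small //= => ec.
  have /permP/(_ (fun i => i <= s)) := puv.
  by rewrite (count_cat _ u') (count_cat _ v') !countc // ec => /addnI.
have kk : k = k'.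
  have /permP/(_ (pred1 c)) := puv.
  have z K : all (fun i => i < c) K -> count_mem c K = 0.
    by move=> /allP Kc; apply/count_memPn/negP => /Kc; rewrite ltnn.
  have zp K : all (fun i => i < c) K -> count_mem c (pairs c K) = size K.
    elim: K => //= i K IHK /andP[ic /IHK ->]; rewrite eqxx -val_eqE /=.
    by rewrite (ltn_eqF ic).
  rewrite !count_cat !zp // (z u') // (z v') // !count_nseq /= eqxx !mul1n !add0n.
  by rewrite (perm_size pL) => /addnI.
have cL : cong (pairs c L ++ nseq k c) (pairs c L' ++ nseq k' c).
  rewrite kk; apply/cong_catr/cong_pairs_perm => //.
  by apply: sub_all Lc => i /ltnW.
have pu' : perm_eq u' v'.
  have [pc _] := chinese_invariants cL.
  by rewrite -(perm_cat2r (pairs c L ++ nseq k c)) (perm_trans puv) // perm_cat2l perm_sym.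
apply: CongruenceTrans cu _; apply: CongruenceSym.
apply: CongruenceTrans cv _; apply: CongruenceSym.
apply: CongruenceCat cL; apply: IH => // s t st tn.
(* For $t\le c$ equal content turns equal exponents of $p$ into equal exponents of $q$; for $t>c$ no
   letter acts as $q$ and the content suffices. *)
case: (leqP t c) => tc.
  have := word_bicyclic_balance st pu'; rewrite (e1 s t st tc) => /addnI e2.
  by rewrite [LHS]surjective_pairing (e1 s t st tc) -e2 -surjective_pairing.
have small w : all (fun i : 'I_n => i < d) w -> all (fun i : 'I_n => i < t) w.
  by apply: sub_all => i id; exact: ltn_trans id tc.
by rewrite !word_bicyclic_small ?small //; move/permP: pu' => ->.
Qed.

Lemma chinese_complete u v : perm_eq u v ->
  (forall s t, s < t -> t < n -> word_bicyclic s t u = word_bicyclic s t v) ->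
  cong u v.
Proof. by apply: (@chinese_complete_bounded n); apply/allP. Qed.

End Words.

(** * Prime and maximal left ideals *)

Section RadicalTheory.
Local Open Scope ring_scope.
Local Open Scope classical_set_scope.
Variable R : nzRingType.
Implicit Types (I J P : set R) (a b x y z : R).

Lemma left_idealN I x : left_ideal I -> I x -> I (- x).
Proof. by move=> hI Ix; rewrite -sub0r; apply: left_idealB => //; exact: left_ideal0. Qed.

Lemma left_idealD I x y : left_ideal I -> I x -> I y -> I (x + y).
Proof.
by move=> hI Ix Iy; rewrite -[y]opprK; apply: left_idealB => //; exact: left_idealN.
Qed.

Lemma left_ideal_proper1 I : left_ideal I -> I <> setT <-> ~ I 1.
Proof.
move=> hI; split=> [nT I1|I1 IT]; last by apply: I1; rewrite IT.
by apply/nT/seteqP; split=> // x _; rewrite -[x]mulr1; exact: left_idealM.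
Qed.

(** This set is the annihilator of the simple module $R/I$: primitive ideals are prime. *)
Lemma prime_ideal_core I : maximal_left_ideal I ->
  prime_ideal [set x | forall y, I (x * y)].
Proof.
move=> [hI /(left_ideal_proper1 hI) I1 Imax].
have coreI x : (forall y, I (x * y)) -> I x by move/(_ 1); rewrite mulr1.
split.
- split; first split=> [y|x y hx hy z|a x hx y].
  + by rewrite mul0r; exact: left_ideal0.
  + by rewrite mulrBl; exact: left_idealB.
  + by rewrite -mulrA; exact: left_idealM.
  + by move=> x a hx y; rewrite -mulrA.
- by move=> eT; apply/I1/coreI; have : setT (1 : R) by []; rewrite -eT.
- move=> X Y [hX Xr] [hY Yr] XY.
  have [YI|/existsNP[y0 /not_implyP[Yy0 Iy0]]] := pselect (forall y, Y y -> I y).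
    by right=> y Yy z; exact/YI/Yr.
  left=> x0 Xx0 x1; have : X (x0 * x1) by exact: Xr.
  move: (x0 * x1) => x Xx.
  (* As $Y\not\subseteq I$, maximality makes $J=Y+I$ the whole ring; from $1=y+i$ follows
     $x=xy+xi\in I$. *)
  pose J : set R := [set z | exists y i, [/\ Y y, I i & z = y + i]].
  have hJ : left_ideal J.
    split.
    + by exists 0, 0; rewrite addr0; split=> //; exact: left_ideal0.
    + move=> _ _ [y [i [Yy Ii ->]]] [y' [i' [Yy' Ii' ->]]].
      by exists (y - y'), (i - i'); rewrite opprD addrACA; split=> //; exact: left_idealB.
    + move=> a _ [y [i [Yy Ii ->]]].
      by exists (a * y), (a * i); rewrite mulrDr; split=> //; exact: left_idealM.
  have [JI|JT] : J = I \/ J = setT.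
  + apply: Imax => // i Ii; exists 0, i; rewrite add0r; split=> //; exact: left_ideal0.
  + case: Iy0; rewrite -JI; exists y0, 0; rewrite addr0; split=> //; exact: left_ideal0.
  + have : J 1 by rewrite JT.
    move=> [y [i [Yy Ii e1]]]; rewrite -[x]mulr1 e1 mulrDr.
    apply: left_idealD => //; last exact: left_idealM.
    apply/coreI/XY; exists [:: (x, y)]; rewrite big_seq1; split=> // p.
    by rewrite inE => /eqP ->.
Qed.

Lemma prime_radical_sub_jacobson : prime_radical R `<=` jacobson_radical R.
Proof.
by move=> x px I mI; have := px _ (prime_ideal_core mI) 1; rewrite mulr1.
Qed.

Lemma maximal_left_ideal_exists J : left_ideal J -> ~ J 1 ->
  exists I, maximal_left_ideal I /\ J `<=` I.
Proof.
move=> hJ J1.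
(* Zorn's lemma is applied to sets whose union with [J] is a proper left ideal, so that the empty
   chain has an admissible union as well. *)
pose P : set (set R) := [set X | left_ideal (J `|` X) /\ ~ (J `|` X) 1].
have [F FP Ftot|A [[hA A1] Amax]] := @Zorn_bigcup _ P.
  have up x y : (J `|` \bigcup_(X in F) X) x -> (J `|` \bigcup_(X in F) X) y ->
      (J x /\ J y) \/ exists2 X, F X & (J `|` X) x /\ (J `|` X) y.
    move=> [Jx|[X FX Xx]] [Jy|[Y FY Yy]]; [by left| | |]; right.
    - by exists Y => //; split; [left|right].
    - by exists X => //; split; [right|left].
    - have [XY|YX] := Ftot X Y FX FY.
        by exists Y => //; split; right=> //; exact: XY.
      by exists X => //; split; right=> //; exact: YX.
  have sub X x : F X -> (J `|` X) x -> (J `|` \bigcup_(X in F) X) x.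
    by move=> FX [Jx|Xx]; [left|right; exists X].
  split; last by move=> [//|[X FX X1]]; have [_] := FP X FX; apply; right.
  split.
  - by left; exact: left_ideal0.
  - move=> x y hx hy; have [[Jx Jy]|[X FX [Xx Xy]]] := up _ _ hx hy.
      by left; exact: left_idealB.
    by apply: (sub X) => //; have [hX _] := FP X FX; exact: left_idealB.
  - move=> a x hx; have [[Jx _]|[X FX [Xx _]]] := up _ _ hx hx.
      by left; exact: left_idealM.
    by apply: (sub X) => //; have [hX _] := FP X FX; exact: left_idealM.
exists (J `|` A); split; last by move=> x; left.
split=> // [|I hI AI]; first exact/(left_ideal_proper1 hA).
have [I1|I1] := pselect (I 1).
  right; apply/seteqP; split=> // x _; rewrite -[x]mulr1; exact: left_idealM.
have JI : J `|` I = I by apply/setUidPr => x Jx; apply: AI; left.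
left; apply/seteqP; split=> // x Ix; right; apply: contrapT => Ax.
apply: (Amax I); last by split; rewrite JI.
by split=> [y Ay|IA]; [apply: AI; right | exact/Ax/IA].
Qed.

(** Otherwise $R(1-ax)$ lies in a maximal left ideal, which also contains $ax$ and hence 1. *)
Lemma jacobson_left_inverse x a : jacobson_radical R x ->
  exists r, r * (1 - a * x) = 1.
Proof.
move=> jx; pose J : set R := [set z | exists r, z = r * (1 - a * x)].
have [[r e]|J1] := pselect (J 1); first by exists r.
have hJ : left_ideal J.
  split; first by exists 0; rewrite mul0r.
    by move=> _ _ [r ->] [r' ->]; exists (r - r'); rewrite mulrBl.
  by move=> b _ [r ->]; exists (b * r); rewrite mulrA.
have [I [mI JI]] := maximal_left_ideal_exists hJ J1.
have [hI /(left_ideal_proper1 hI) I1 _] := mI.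
case: I1; rewrite -(subrK (a * x) 1); apply: left_idealD => //.
  by apply: JI; exists 1; rewrite mul1r.
by apply: left_idealM => //; apply: jx.
Qed.

End RadicalTheory.

(** * Ideals spanned by binomials *)

Section BinomialSpan.
Local Open Scope ring_scope.
Variables (K : fieldType) (M : monomType).
Local Notation R := {malg K[M]}.
Implicit Types (x y z : M) (f g h : R) (e : M -> M -> Prop).

Lemma malgUM (c d : K) x y : << c *g x >> * << d *g y >> = << c * d *g mmul x y >> :> R.
Proof. by rewrite malgM_def fgmulUU. Qed.

Inductive binomial_span e : R -> Prop :=
| BinomialSpan0 : binomial_span e 0
| BinomialSpanD c x y f : e x y -> binomial_span e f ->
    binomial_span e (<< c *g x >> - << c *g y >> + f).

Lemma binomial_span_add e f g :
  binomial_span e f -> binomial_span e g -> binomial_span e (f + g).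
Proof.
move=> + hg; elim=> [|c x y h exy _ IH]; first by rewrite add0r.
by rewrite -addrA; exact: BinomialSpanD.
Qed.

Lemma binomial_span_opp e f : binomial_span e f -> binomial_span e (- f).
Proof.
elim=> [|c x y h exy _ IH]; first by rewrite oppr0; exact: BinomialSpan0.
have -> : - (<< c *g x >> - << c *g y >> + h) =
    << - c *g x >> - << - c *g y >> + - h.
  by rewrite !monalgUN opprK opprD opprB [- _ + _]addrC.
exact: BinomialSpanD.
Qed.

Lemma binomial_span1 e c x y :
  e x y -> binomial_span e (<< c *g x >> - << c *g y >>).
Proof.
move=> exy; rewrite -[X in binomial_span e X]addr0.
by apply: BinomialSpanD => //; exact: BinomialSpan0.
Qed.

Lemma binomial_span_sum e (T : eqType) (s : seq T) (F : T -> R) :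
  (forall i, i \in s -> binomial_span e (F i)) ->
  binomial_span e (\sum_(i <- s) F i).
Proof.
move=> hF; rewrite big_seq.
by apply: (big_ind (binomial_span e)) => //; [exact: BinomialSpan0 | exact: binomial_span_add].
Qed.

Lemma binomial_span_mulr e f g :
  (forall x y z, e x y -> e (mmul z x) (mmul z y)) ->
  binomial_span e f -> binomial_span e (g * f).
Proof.
move=> eM; rewrite (monalgE g) mulr_suml => hf.
apply: binomial_span_sum => z _.
elim: hf => [|c x y h exy _ IH]; first by rewrite mulr0; exact: BinomialSpan0.
by rewrite mulrDr mulrBr !malgUM; apply: BinomialSpanD => //; exact: eM.
Qed.

Lemma binomial_span_mull e f g :
  (forall x y z, e x y -> e (mmul x z) (mmul y z)) ->
  binomial_span e f -> binomial_span e (f * g).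
Proof.
move=> eM; rewrite (monalgE g) mulr_sumr => hf.
apply: binomial_span_sum => z _.
elim: hf => [|c x y h exy _ IH]; first by rewrite mul0r; exact: BinomialSpan0.
by rewrite mulrDl mulrBl !malgUM; apply: BinomialSpanD => //; exact: eM.
Qed.

Lemma binomial_span_ideal e :
  (forall x y z, e x y -> e (mmul z x) (mmul z y)) ->
  (forall x y z, e x y -> e (mmul x z) (mmul y z)) ->
  two_sided_ideal (binomial_span e).
Proof.
move=> eMl eMr; split; last by move=> f g; exact: binomial_span_mull.
split; first exact: BinomialSpan0.
- move=> f g hf hg; apply: binomial_span_add => //; exact: binomial_span_opp.
- by move=> g f; exact: binomial_span_mulr.
Qed.

(** The product $(x-x')(y-y')$ is both $(xy-xy')-(x'y-x'y')$ and $(xy-x'y)-(xy'-x'y')$; the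
    hypothesis makes one of the two groupings work for each pair of binomials. *)
Lemma binomial_span_mul e e1 e2 f g :
  (forall x x' y y', e1 x x' -> e2 y y' ->
     (e (mmul x y) (mmul x y') /\ e (mmul x' y) (mmul x' y')) \/
     (e (mmul x y) (mmul x' y) /\ e (mmul x y') (mmul x' y'))) ->
  binomial_span e1 f -> binomial_span e2 g -> binomial_span e (f * g).
Proof.
move=> he hf hg; elim: hf => [|c x x' h exx' _ IH].
  by rewrite mul0r; exact: BinomialSpan0.
rewrite mulrDl; apply: binomial_span_add => // {h IH}.
elim: hg => [|d y y' h eyy' _ IH]; first by rewrite mulr0; exact: BinomialSpan0.
rewrite mulrDr; apply: binomial_span_add => // {h IH}.
rewrite mulrBl !mulrBr !malgUM.
have [[e1' e2']|[e1' e2']] := he _ _ _ _ exx' eyy'.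
  apply: binomial_span_add; first exact: binomial_span1.
  exact/binomial_span_opp/binomial_span1.
rewrite opprB [X in _ + X]addrC addrACA.
apply: binomial_span_add; first exact: binomial_span1.
by rewrite addrC -opprB; exact/binomial_span_opp/binomial_span1.
Qed.
End BinomialSpan.

(** * The ideals attached to sets of index pairs *)

Section ChineseBicyclic.
Variable n : nat.
Local Notation M := (chinese_monoid n).
Implicit Types (x y z : M) (a b : 'I_n * 'I_n) (A : {set 'I_n * 'I_n}).

Definition bicyclic_image a x : nat * nat := word_bicyclic a.1 a.2 (repr x).

Definition index_pairs : {set 'I_n * 'I_n} := [set a : 'I_n * 'I_n | a.1 < a.2].

Lemma repr_class w :
  congruence_closure (@chinese_relation n) (repr (chinese_class w)) w.
Proof. by apply/chinese_classP; rewrite chinese_class_repr. Qed.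

Lemma repr_mul x y : congruence_closure (@chinese_relation n)
  (repr (mmul x y)) (repr x ++ repr y).
Proof. exact: repr_class. Qed.

Lemma bicyclic_image_class a w : a.1 < a.2 ->
  bicyclic_image a (chinese_class w) = word_bicyclic a.1 a.2 w.
Proof. by move=> la; have [_] := chinese_invariants (repr_class w); apply. Qed.

Lemma bicyclic_imageM a x y : a.1 < a.2 ->
  bicyclic_image a (mmul x y) =
  bicyclic_mul (bicyclic_image a x) (bicyclic_image a y).
Proof. by move=> la; rewrite bicyclic_image_class // word_bicyclic_cat. Qed.

(** The ideal $I_A$ is [binomial_span (agree A)]. *)
Definition agree A x y :=
  perm_eq (repr x) (repr y) /\
  {in A, forall a, bicyclic_image a x = bicyclic_image a y}.

Lemma perm_repr_mul x y z t : perm_eq (repr x) (repr y) ->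
  perm_eq (repr z) (repr t) -> perm_eq (repr (mmul x z)) (repr (mmul y t)).
Proof.
move=> xy zt; have [p _] := chinese_invariants (repr_mul x z).
have [q _] := chinese_invariants (repr_mul y t).
by rewrite (permPl p) perm_sym (permPl q) perm_sym perm_cat.
Qed.

Lemma agreeMl A x y z : A \subset index_pairs -> agree A x y ->
  agree A (mmul z x) (mmul z y).
Proof.
move=> /fintype.subsetP hA [p e]; split; first exact: perm_repr_mul.
by move=> a aA; have := hA a aA; rewrite inE => la; rewrite !bicyclic_imageM // e.
Qed.

Lemma agreeMr A x y z : A \subset index_pairs -> agree A x y ->
  agree A (mmul x z) (mmul y z).
Proof.
move=> /fintype.subsetP hA [p e]; split; first exact: perm_repr_mul.
by move=> a aA; have := hA a aA; rewrite inE => la; rewrite !bicyclic_imageM // e.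
Qed.

Lemma agree_index_pairs x y : agree index_pairs x y -> x = y.
Proof.
move=> [p e]; rewrite -(chinese_class_repr x) -(chinese_class_repr y).
apply/chinese_classP/chinese_complete => // s t st tn.
by apply: (e (Ordinal (ltn_trans st tn), Ordinal tn)); rewrite inE.
Qed.

Lemma bicyclic_image_balance a x y : a.1 < a.2 -> perm_eq (repr x) (repr y) ->
  (bicyclic_image a x).1 + (bicyclic_image a y).2 =
  (bicyclic_image a y).1 + (bicyclic_image a x).2.
Proof. by move=> la; exact: word_bicyclic_balance. Qed.

(* In (x, x') only the b-coordinate may change, in (y, y') only the
   a-coordinate.  If q^j(x) in coordinate b is absorbed by p^i(y), then x and x'
   become equal in the product; otherwise monotonicity in the index pair forces
   p^i(y) and p^i(y') in coordinate a to be absorbed by x and x'. *)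
Lemma agree_mul A a b x x' y y' : A \subset index_pairs -> a \in A -> b \in A ->
  a.1 <= b.1 -> a.2 <= b.2 -> a != b ->
  agree (A :\ b) x x' -> agree (A :\ a) y y' ->
  (agree A (mmul x y) (mmul x y') /\ agree A (mmul x' y) (mmul x' y')) \/
  (agree A (mmul x y) (mmul x' y) /\ agree A (mmul x y') (mmul x' y')).
Proof.
move=> /fintype.subsetP hA aA bA ab1 ab2 ab [px ex] [py ey].
have := hA a aA; have := hA b bA; rewrite !inE => lb la.
have exa : bicyclic_image a x = bicyclic_image a x' by apply: ex; rewrite !inE ab.
have eyb : bicyclic_image b y = bicyclic_image b y'.
  by apply: ey; rewrite !inE eq_sym ab.
have mono z : (bicyclic_image a z).1 <= (bicyclic_image b z).1 /\
    (bicyclic_image b z).2 <= (bicyclic_image a z).2.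
  exact: word_bicyclic_mono.
have bx := bicyclic_image_balance lb px; have bya := bicyclic_image_balance la py.
(* The factors agree away from [c], so only coordinate [c] of the products has to be compared. *)
have other (u u' v v' : M) c : perm_eq (repr u) (repr u') ->
    perm_eq (repr v) (repr v') ->
    bicyclic_image c (mmul u v) = bicyclic_image c (mmul u' v') ->
    {in A :\ c, forall d, bicyclic_image d u = bicyclic_image d u'} ->
    {in A :\ c, forall d, bicyclic_image d v = bicyclic_image d v'} ->
    agree A (mmul u v) (mmul u' v').
  move=> pu pv ec eu ev; split; first exact: perm_repr_mul.
  move=> d dA; have [->//|dc] := eqVneq d c.
  have := hA d dA; rewrite inE => ld.
  by rewrite !bicyclic_imageM // eu ?ev // !inE dc.
have [/andP[jx jx']|] := boolP (((bicyclic_image b x).2 <= (bicyclic_image b y).1) &&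
    ((bicyclic_image b x').2 <= (bicyclic_image b y).1)).
  right; split; apply: (other _ _ _ _ b) => //; rewrite !bicyclic_imageM // -?eyb.
    by rewrite /bicyclic_mul; congr (_, _); lia.
  by rewrite /bicyclic_mul; congr (_, _); lia.
move=> jx; have [my _] := mono y; have [my' _] := mono y'.
have [_ mx] := mono x; have [_ mx'] := mono x'.
rewrite -eyb in my'; rewrite -exa in mx'.
left; split; apply: (other _ _ _ _ a) => //; rewrite !bicyclic_imageM // -?exa;
  rewrite /bicyclic_mul; congr (_, _); lia.
Qed.

Definition antichain A := forall a b, a \in A -> b \in A ->
  a.1 <= b.1 -> a.2 <= b.2 -> a = b.

Local Open Scope ring_scope.
Local Open Scope classical_set_scope.

(** Descent from the set of all pairs, whose ideal is zero: as long as two elements of [A] are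
    comparable, primeness allows one of them to be dropped. *)
Lemma prime_ideal_antichain (K : fieldType) (P : set {malg K[M]}) :
  prime_ideal P -> exists A, [/\ A \subset index_pairs, antichain A &
    binomial_span (agree A) `<=` P].
Proof.
move=> hP.
have ideal A : A \subset index_pairs ->
    two_sided_ideal (@binomial_span K M (agree A)).
  by move=> hA; apply: binomial_span_ideal => x y z; [exact: agreeMl|exact: agreeMr].
suff descend d A : A \subset index_pairs -> (#|A| <= d)%N ->
    binomial_span (agree A) `<=` P -> exists A', [/\ A' \subset index_pairs,
    antichain A' & binomial_span (agree A') `<=` P].
  apply: (descend _ _ (subxx index_pairs) (leqnn _)) => f.
  elim=> [|c x y g /agree_index_pairs -> _ Pg]; last by rewrite subrr add0r.
  by case: hP => -[[]].
elim: d A => [|d IH] A hA Ad AP.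
  exists A; split=> // a b; move: Ad; rewrite leqn0 cards_eq0 => /eqP ->.
  by rewrite inE.
have [anti|/existsNP[a /existsNP[b]]] := pselect (antichain A); first by exists A.
move=> /not_implyP[aA /not_implyP[bA /not_implyP[ab1 /not_implyP[ab2 /eqP ab]]]].
have smaller c : c \in A -> A :\ c \subset index_pairs /\ (#|A :\ c| <= d)%N.
  move=> cA; split; first exact: fintype.subset_trans (subD1set A c) hA.
  by move: Ad; rewrite (cardsD1 c) cA.
have [sa da] := smaller a aA; have [sb db] := smaller b bA.
have := prime_idealP hP (ideal _ sb) (ideal _ sa).
case=> [_ [s [hs ->]]|Pb|Pa]; [| exact: IH Pb | exact: IH Pa].
apply/AP/binomial_span_sum => p /hs[hp1 hp2].
apply: binomial_span_mul hp1 hp2 => x x' y y'.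
exact: agree_mul.
Qed.

End ChineseBicyclic.

(** * Antichains and the action on row vectors *)

Section Reachable.
Variables (n : nat) (A : {set 'I_n * 'I_n}).
Hypothesis A_pairs : A \subset index_pairs n.
Hypothesis A_antichain : antichain A.
Implicit Types (a b : 'I_n * 'I_n) (v : 'I_n * 'I_n -> nat * nat).

(** Only the image in $B^A$ is prescribed; the content is left free and later shows up as a power of
    $X$. *)
Definition reachable v :=
  exists w : seq 'I_n, {in A, forall a, word_bicyclic a.1 a.2 w = v a}.

Lemma eq_reachable v v' : {in A, v =1 v'} -> reachable v -> reachable v'.
Proof. by move=> e [w h]; exists w => a aA; rewrite h // e. Qed.

Lemma reachable1 : reachable (fun=> (0, 0)).
Proof. by exists [::]. Qed.

Lemma reachableM v v' : reachable v -> reachable v' ->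
  reachable (fun a => bicyclic_mul (v a) (v' a)).
Proof.
by move=> [w h] [w' h']; exists (w ++ w') => a aA; rewrite word_bicyclic_cat h // h'.
Qed.

(* An antichain consists of strictly nested intervals, so the generators a.1
   and a.2 act as p and q on the intervals inside a, and trivially outside. *)
Lemma letter_antichain a b : a \in A -> b \in A ->
  bicyclic_letter b.1 b.2 a.1 = (if a.1 <= b.1 then (1, 0) else (0, 0)) /\
  bicyclic_letter b.1 b.2 a.2 = (if a.1 <= b.1 then (0, 1) else (0, 0)).
Proof.
move=> aA bA; have /fintype.subsetP hA := A_pairs.
have := hA a aA; have := hA b bA; rewrite !inE => lb la.
have ab := A_antichain aA bA; have ba := A_antichain bA aA.
rewrite /bicyclic_letter; case: (leqP a.1 b.1) => [le1|gt1].
  have le2 : b.2 <= a.2.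
    rewrite leqNgt; apply/negP => lt2.
    by have e := ab le1 (ltnW lt2); rewrite e ltnn in lt2.
  by rewrite leqNgt (leq_trans lb le2) le2.
have lt2 : a.2 < b.2.
  rewrite ltnNge; apply/negP => ge2.
  by have e := ba (ltnW gt1) ge2; rewrite e ltnn in gt1.
rewrite [b.2 <= a.1]leqNgt (ltn_trans la lt2) [b.2 <= a.2]leqNgt lt2.
by rewrite [a.2 <= b.1]leqNgt (ltn_trans gt1 la).
Qed.

(** Downward induction on [k]: either [k] is the left end of some [a] in [A], and the letters [a.1]
    and [a.2] do, or [k] can be replaced by its successor. *)
Lemma reachable_inner k :
  reachable (fun a => if k <= a.1 then (1, 0) else (0, 0)) /\
  reachable (fun a => if k <= a.1 then (0, 1) else (0, 0)).
Proof.
have [d] : exists d, n <= k + d by exists n; rewrite leq_addl.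
elim: d k => [|d IH] k.
  rewrite addn0 => nk.
  by split; apply: eq_reachable reachable1 => a _; rewrite leqNgt (leq_trans (ltn_ord a.1)).
rewrite addnS -addSn => /IH[U D].
have [[a aA ak]|no] := pselect (exists2 a, a \in A & a.1 = k :> nat).
  rewrite -ak; split; [exists [:: a.1] | exists [:: a.2]] => b bA;
    rewrite /= bicyclic_mulm1; by have [] := letter_antichain aA bA.
have e a : a \in A -> (k < a.1) = (k <= a.1).
  move=> aA; rewrite ltn_neqAle; case: eqP => // ka; case: no.
  by exists a.
by split; [apply: eq_reachable U | apply: eq_reachable D] => a aA; rewrite e.
Qed.

Lemma reachable_single a : a \in A ->
  reachable (fun b => if b == a then (1, 0) else (0, 0)) /\
  reachable (fun b => if b == a then (0, 1) else (0, 0)).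
Proof.
move=> aA; have [U D] := reachable_inner a.1; have [U' D'] := reachable_inner a.1.+1.
have e b : b \in A -> (b == a) = (a.1 <= b.1) && ~~ (a.1 < b.1).
  move=> bA; apply/eqP/idP => [->|]; first by rewrite leqnn ltnn.
  rewrite -leqNgt => /andP[ab ba].
  case: (leqP a.2 b.2) => le2; first by apply/esym/A_antichain.
  exact: A_antichain (ltnW le2).
(* Strictly inside [a] the two factors cancel by $qp=1$; only the coordinate [a] itself is left. *)
split; [apply: eq_reachable (reachableM D' U) | apply: eq_reachable (reachableM D U')];
  move=> b bA; rewrite e //=; case: (ltnP a.1 b.1) => ab.
- by rewrite (ltnW ab).
- by rewrite andbT; case: leqP.
- by rewrite (ltnW ab).
- by rewrite andbT; case: leqP.
Qed.

Lemma reachable_powers (m : 'I_n * 'I_n -> nat) :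
  reachable (fun a => (m a, 0)) /\ reachable (fun a => (0, m a)).
Proof.
have [d] : exists d, \sum_(a in A) m a <= d by exists (\sum_(a in A) m a).
elim: d m => [|d IH] m.
  rewrite leqn0 sum_nat_eq0 => /forallP m0.
  by split; apply: eq_reachable reachable1 => a aA; have /implyP/(_ aA)/eqP-> := m0 a.
have [[a aA ma] md|no _] := pselect (exists2 a, a \in A & 0 < m a); last first.
  split; apply: eq_reachable reachable1 => a aA; case: (posnP (m a)) => [->//|ma];
  by case: no; exists a.
have [|U D] := IH (fun b => if b == a then (m a).-1 else m b).
  move: md; rewrite (bigD1 a) //= [X in _ -> X <= _](bigD1 a) //= eqxx.
  rewrite [X in _ -> _ + X <= _](eq_bigr m) => [|b /andP[_ /negbTE->]] //; lia.
have [U1 D1] := reachable_single aA.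
split; [apply: eq_reachable (reachableM U U1) | apply: eq_reachable (reachableM D D1)];
  move=> b _; case: eqVneq => [->|_]; rewrite /bicyclic_mul /=; congr (_, _); lia.
Qed.

Lemma reachable_positive : 0 < n ->
  exists2 w : seq 'I_n, {in A, forall a, word_bicyclic a.1 a.2 w = (0, 0)} & 0 < size w.
Proof.
move=> n0; have [_ [w hw]] := reachable_powers (fun=> 1).
exists (rcons w (Ordinal n0)) => [a aA|]; last by rewrite size_rcons.
by rewrite -cats1 word_bicyclic_cat hw.
Qed.

End Reachable.

Section BicyclicAction.
Variable I : finType.
Implicit Types (v : I -> nat * nat) (m : {ffun I -> nat}).

(** The shift representation on basis vectors: $q$ lowers a coordinate, $p$ raises it, and [None]
    stands for the zero vector. *)
Definition bicyclic_act v m : option {ffun I -> nat} :=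
  if [forall a, (v a).2 <= m a] then Some [ffun a => m a - (v a).2 + (v a).1]
  else None.

Lemma eq_bicyclic_act v v' : v =1 v' -> bicyclic_act v =1 bicyclic_act v'.
Proof.
move=> e m; rewrite /bicyclic_act; under eq_forallb do rewrite e.
by case: ifP => // _; congr Some; apply/ffunP => a; rewrite !ffunE e.
Qed.

Lemma bicyclic_actM v v' m :
  bicyclic_act (fun a => bicyclic_mul (v a) (v' a)) m =
  obind (bicyclic_act v) (bicyclic_act v' m).
Proof.
rewrite {1 3}/bicyclic_act.
case: (boolP [forall a, (v' a).2 <= m a]) => [/forallP h'|]; last first.
  move=> /forallPn[a h']; case: forallP => // h.
  by have := h a; rewrite /bicyclic_mul /=; lia.
rewrite /= /bicyclic_act.
have -> : [forall a, (bicyclic_mul (v a) (v' a)).2 <= m a] =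
    [forall a, (v a).2 <= [ffun a => m a - (v' a).2 + (v' a).1] a].
  by apply: eq_forallb => a; rewrite ffunE /bicyclic_mul /=; have := h' a; lia.
case: forallP => // h; congr Some; apply/ffunP => a; rewrite !ffunE /bicyclic_mul /=.
by have := h' a; have := h a; rewrite ffunE; lia.
Qed.

End BicyclicAction.

Section RowAction.
Local Open Scope ring_scope.
Variables (K : fieldType) (n N : nat) (A : {set 'I_n * 'I_n}).
Hypothesis A_pairs : A \subset index_pairs n.
Local Notation M := (chinese_monoid n).
Local Notation R := {malg K[M]}.
Local Notation state := {ffun {a : 'I_n * 'I_n | a \in A} -> nat}.
Implicit Types (x y : M) (f g : R) (m s : state) (k : state -> {poly K}).

Definition word_weight (w : seq 'I_n) : nat := (\sum_(i <- w) N ^ i)%N.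

Definition weight x : nat := word_weight (repr x).

Lemma perm_word_weight u v : perm_eq u v -> word_weight u = word_weight v.
Proof. by move=> uv; rewrite /word_weight (perm_big _ uv). Qed.

Lemma weight_class w : weight (chinese_class w) = word_weight w.
Proof.
by apply: perm_word_weight; have [] := chinese_invariants (repr_class w).
Qed.

Lemma weightM x y : weight (mmul x y) = (weight x + weight y)%N.
Proof. by rewrite weight_class /word_weight big_cat. Qed.

Definition act x : state -> option state :=
  bicyclic_act (fun a => bicyclic_image (val a) x).

Lemma index_pair_lt (a : {a : 'I_n * 'I_n | a \in A}) :
  ((val a).1 < (val a).2)%N.
Proof. by have /fintype.subsetP/(_ _ (valP a)) := A_pairs; rewrite inE. Qed.

Lemma actM x y m : act (mmul x y) m = obind (act x) (act y m).
Proof.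
rewrite /act -bicyclic_actM; apply: eq_bicyclic_act => a.
exact/bicyclic_imageM/index_pair_lt.
Qed.

Lemma act_class (w : seq 'I_n) (v : 'I_n * 'I_n -> nat * nat) m :
  {in A, forall a : 'I_n * 'I_n, word_bicyclic a.1 a.2 w = v a} ->
  act (chinese_class w) m = bicyclic_act (fun a => v (val a)) m.
Proof.
move=> h; apply: eq_bicyclic_act => a.
by rewrite bicyclic_image_class ?index_pair_lt // h //; exact: valP.
Qed.

(* A right action of K[M] on row vectors with entries in K[X].  The generator of
   index i carries the factor X^(N^i) (Kronecker substitution), so that for large
   N the power of X determines the content. *)
Definition row_act k f m : {poly K} :=
  mmap (@polyC K) (fun x => 'X^(weight x) * oapp k 0 (act x m)) f.

Lemma row_actE k f m : row_act k f m =
  \sum_(x <- msupp f) (f@_x)%:P * ('X^(weight x) * oapp k 0 (act x m)).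
Proof. by []. Qed.

Lemma row_actU k c x m :
  row_act k << c *g x >> m = c%:P * ('X^(weight x) * oapp k 0 (act x m)).
Proof. exact: mmapU. Qed.

Lemma row_actB k f g m : row_act k (f - g) m = row_act k f m - row_act k g m.
Proof. exact: raddfB. Qed.

Lemma row_act_sum (T : Type) (r : seq T) (F : T -> R) k m :
  row_act k (\sum_(i <- r) F i) m = \sum_(i <- r) row_act k (F i) m.
Proof. exact: raddf_sum. Qed.

Lemma row_actM k f g m : row_act k (f * g) m = row_act (row_act k f) g m.
Proof.
rewrite (monalgE g) mulr_sumr !row_act_sum; apply: eq_bigr => y _.
rewrite [RHS]row_actU {1}(monalgE f) mulr_suml row_act_sum.
rewrite (eq_bigr (fun x => (f@_x)%:P * ('X^(weight x) *
   ((g@_y)%:P * ('X^(weight y) * oapp k 0 (obind (act x) (act y m))))))).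
  case: (act y m) => [s|] /=; last by rewrite !mulr0 big1 // => x _; rewrite !mulr0.
  rewrite row_actE !mulr_sumr; apply: eq_bigr => x _.
  move: ('X^_) ('X^_) (oapp _ _ _) => b d t.
  rewrite [LHS]mulrA [X in _ * X]mulrA [RHS]mulrA [X in _ = _ * X]mulrA.
  by rewrite mulrCA.
move=> x _; rewrite malgUM row_actU actM weightM polyCM exprD -!mulrA; congr (_ * _).
by rewrite mulrCA.
Qed.

Lemma act1 m : act (chinese_one n) m = Some m.
Proof.
rewrite (@act_class [::] (fun=> (0, 0)%N)) // /bicyclic_act; case: forallP => [_|[]//].
by congr Some; apply/ffunP => a; rewrite ffunE subn0 addn0.
Qed.

Lemma row_act1 k m : row_act k 1 m = k m.
Proof.
rewrite -[1]/(<< 1 *g chinese_one n >> : R) row_actU act1 /=.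
by rewrite weight_class /word_weight big_nil expr0 polyC1 !mul1r.
Qed.

End RowAction.

(** Uniqueness of base [N] digits, by which the content is recovered from [word_weight]; the lowest
    digit is the residue modulo [N]. *)
Lemma base_digits_inj n N (c d : 'I_n -> nat) :
  (forall i, c i < N) -> (forall i, d i < N) ->
  \sum_(i < n) c i * N ^ i = \sum_(i < n) d i * N ^ i -> c =1 d.
Proof.
elim: n c d => [|n IH] c d hc hd; first by move=> _ [].
have N0 : 0 < N by exact: leq_ltn_trans (hc ord0).
have shift (f : 'I_n.+1 -> nat) : \sum_(i < n.+1) f i * N ^ i =
    (\sum_(i < n) f (lift ord0 i) * N ^ i) * N + f ord0.
  rewrite big_ord_recl expn0 muln1 addnC big_distrl; congr (_ + _).
  by apply: eq_bigr => i _ /=; rewrite /bump /= add1n expnSr mulnA.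
rewrite !shift => e.
have e0 : c ord0 = d ord0.
  by have := congr1 (modn^~ N) e; rewrite /= !modnMDl !modn_small.
move: e; rewrite e0 => /addIn/eqP; rewrite eqn_pmul2r // => /eqP/IH e.
by move=> i; case: (unliftP ord0 i) => [j ->|-> //]; apply: e.
Qed.

(** * Matrix units up to powers of $X$, and the Jacobson radical *)

Section JacobsonRadical.
Local Open Scope ring_scope.
Variables (K : fieldType) (n : nat) (A : {set 'I_n * 'I_n}).
Hypothesis n_gt0 : (0 < n)%N.
Hypothesis A_pairs : A \subset index_pairs n.
Hypothesis A_antichain : antichain A.
Local Notation M := (chinese_monoid n).
Local Notation R := {malg K[M]}.
Local Notation I := {a : 'I_n * 'I_n | a \in A}.
Local Notation state := {ffun I -> nat}.
Implicit Types (x y : M) (f g : R) (m s : state) (k : state -> {poly K}) (a b : I).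

Lemma word_weight_count N (w : seq 'I_n) :
  word_weight N w = (\sum_(i < n) count_mem i w * N ^ i)%N.
Proof.
rewrite /word_weight; elim: w => [|j w IH]; first by rewrite big_nil big1.
rewrite big_cons IH; under [in RHS]eq_bigr do rewrite /= mulnDl.
rewrite big_split; congr (_ + _)%N.
rewrite (bigD1 j) //= eqxx mul1n big1 ?addn0 // => i /negbTE.
by rewrite eq_sym => ->.
Qed.

Lemma word_weight_inj N (u v : seq 'I_n) : (size u < N)%N -> (size v < N)%N ->
  word_weight N u = word_weight N v -> perm_eq u v.
Proof.
rewrite !word_weight_count => hu hv e; apply/allP => i _; apply/eqP.
apply: (base_digits_inj (c := fun i => count_mem i u)
  (d := fun i => count_mem i v) _ _ e i) => {e}i.
  exact: leq_ltn_trans (count_size _ _) hu.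
exact: leq_ltn_trans (count_size _ _) hv.
Qed.

Definition extend m (a : 'I_n * 'I_n) : nat := oapp m 0%N (insub a).

Lemma extend_val m a : extend m (val a) = m a.
Proof. by rewrite /extend valK. Qed.

(** In coordinate [a], $1-pq$ projects onto the kernel of $q$. Writing 1 as $qp$ gives both terms
    the same content, so a single power of $X$ factors out. *)
Lemma row_act_single N a : exists (g : R) c, forall k s,
  row_act N k g s = 'X^c * (if s a == 0%N then k s else 0).
Proof.
have [[wp hp] [wq hq]] := reachable_single A_pairs A_antichain (valP a).
exists (<< 1 *g chinese_class (wq ++ wp) >> - << 1 *g chinese_class (wp ++ wq) >>).
exists (word_weight N (wq ++ wp)) => k s.
rewrite row_actB !row_actU polyC1 !mul1r !weight_class.
rewrite (perm_word_weight N (permEl (perm_catC wp wq))) -mulrBr; congr (_ * _).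
rewrite (act_class A_pairs (v := fun=> (0, 0)%N)); last first.
  by move=> b bA; rewrite word_bicyclic_cat hp // hq //; case: eqP.
rewrite (act_class A_pairs
  (v := fun b : 'I_n * 'I_n => if b == val a then (1, 1) else (0, 0))%N); last first.
  by move=> b bA; rewrite word_bicyclic_cat hp // hq //; case: eqP.
rewrite /bicyclic_act; case: forallP => [_|[]//] /=.
have -> : [ffun b : I => s b - 0 + 0]%N = s.
  by apply/ffunP => b; rewrite ffunE subn0 addn0.
case: eqP => sa.
  case: forallP => [/(_ a)|_] /=; last by rewrite subr0.
  by rewrite eqxx sa.
case: forallP => [h|[]] /=; last first.
  move=> b; case: eqP => // /val_inj ->; by rewrite /= lt0n; apply/eqP.
rewrite -[RHS](subrr (k s)); congr (_ - k _).
apply/ffunP => b; rewrite ffunE; case: eqP => [/val_inj ->|_] /=.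
  by rewrite subnK // lt0n; apply/eqP.
by rewrite subn0 addn0.
Qed.

Lemma row_act_isolate N (l : seq I) : exists (g : R) c, forall k s,
  row_act N k g s = 'X^c * (if all (fun a => s a == 0%N) l then k s else 0).
Proof.
elim: l => [|a l [g [c hg]]].
  by exists 1, 0%N => k s; rewrite row_act1 // expr0 mul1r.
have [h [d hh]] := row_act_single N a.
exists (g * h), (d + c)%N => k s; rewrite row_actM // hh hg exprD -mulrA /=.
by case: eqP => _ //=; rewrite !mulr0.
Qed.

(** A matrix unit up to a power of $X$: lower by [m'], project onto the zero state, raise to [m].
    The nonempty word [w0] acts trivially and ensures $c>0$. *)
Lemma row_act_rank_one N m m' : (0 < N)%N ->
  exists (g : R) c, (0 < c)%N /\ forall k s,
    row_act N k g s = 'X^c * (if s == m' then k m else 0).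
Proof.
move=> N0; have [w0 h0 size_w0] := reachable_positive A_pairs A_antichain n_gt0.
have [[wu hu] _] := reachable_powers A_pairs A_antichain (extend m).
have [_ [wd hd]] := reachable_powers A_pairs A_antichain (extend m').
have [g [c hg]] := row_act_isolate N (enum {: I}).
exists (<< 1 *g chinese_class (wu ++ w0) >> * g * << 1 *g chinese_class wd >>).
exists (word_weight N wd + (c + word_weight N (wu ++ w0)))%N; split.
  rewrite addnA ltn_addl // /word_weight big_cat ltn_addl //=.
  case: w0 size_w0 {h0} => // i w0 _.
  by rewrite big_cons ltn_addr // expn_gt0 N0.
move=> k s; rewrite row_actM // row_actU polyC1 mul1r weight_class.
rewrite (act_class A_pairs _ hd) exprD -[RHS]mulrA; congr (_ * _).
rewrite /bicyclic_act; case: forallP => [h|h] /=; last first.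
  by case: eqP => [e|_]; [case: h => a; rewrite e extend_val | rewrite mulr0].
rewrite row_actM // hg exprD -mulrA; congr (_ * _).
have -> : all (fun a => [ffun a0 => s a0 - extend m' (val a0) + 0]%N a == 0%N)
    (enum {: I}) = (s == m').
  apply/allP/eqP => [e|-> a _]; last by rewrite ffunE extend_val subnn.
  apply/ffunP => a; apply/eqP; rewrite eqn_leq.
  have := e a (mem_enum _ _); rewrite ffunE addn0 subn_eq0 extend_val => ->.
  by have := h a; rewrite /= extend_val.
case: eqP => [->|_]; last by rewrite mulr0.
rewrite row_actU polyC1 mul1r weight_class; congr (_ * _).
rewrite (act_class A_pairs (v := fun b : 'I_n * 'I_n => (extend m b, 0)%N)); last first.
  by move=> b bA; rewrite word_bicyclic_cat hu // h0 // bicyclic_mulm1.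
rewrite /bicyclic_act; case: forallP => [_|[]//] /=; congr k.
by apply/ffunP => a; rewrite !ffunE !extend_val subnn subn0.
Qed.

Definition same_content x y := perm_eq (repr x) (repr y).

Definition below m x := [forall a : I, ((bicyclic_image (val a) x).2 <= m a)%N].

(** Equal content means equal net shift in each coordinate, so two defined results coincide. *)
Lemma act_same_content x y m m' : same_content x y -> below m x ->
  act x m = Some m' -> below m y -> act y m = Some m'.
Proof.
rewrite /act /bicyclic_act -!/(below m _) => xy bx; rewrite bx => -[<-] by_.
rewrite by_; congr Some; apply/ffunP => a; rewrite !ffunE.
have := bicyclic_image_balance (index_pair_lt A_pairs a) xy.
have /forallP/(_ a) := bx; have /forallP/(_ a) := by_.
case: (bicyclic_image _ x) (bicyclic_image _ y) => [i j] [i' j'] /=; move: (m a) => d; lia.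
Qed.

Lemma jacobson_below_sum f m x0 : jacobson_radical R f ->
  \sum_(x <- msupp f | same_content x x0 && below m x) f@_x = 0.
Proof.
move=> jf; apply/eqP/negP => /negP sum_neq0.
have [x1 x1f /andP[c1 b1]] : exists2 x, x \in msupp f & same_content x x0 && below m x.
  apply: contrapT => no; case/negP: sum_neq0; rewrite big_seq_cond big1 // => x.
  by move=> /andP[xf xc]; case: no; exists x.
have [m' am'] : exists m', act x1 m = Some m'.
  by rewrite /act /bicyclic_act -/(below m x1) b1; eexists.
(* Any [N] above all word lengths in the support would do: the weight then determines the content
   there. *)
pose N := (\sum_(x <- msupp f) (size (repr x)).+1)%N.
have sizeN x : x \in msupp f -> (size (repr x) < N)%N.
  by move=> xf; rewrite /N (big_rem x) //= leq_addr.
have N0 : (0 < N)%N by exact: leq_ltn_trans (sizeN _ x1f).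
have [g [c [c0 hg]]] := row_act_rank_one m m' N0.
pose p := row_act N (fun s => if s == m' then 1 else 0) f m.
(* This coefficient is the sum in question: other contents have other weights, elements not below
   [m] act as zero, and the remaining ones send [m] to [m']. *)
have pE : p`_(weight N x1) != 0.
  apply: contraNneq sum_neq0 => pz; apply/eqP; rewrite -[RHS]pz /p row_actE coef_sum.
  rewrite [LHS]big_mkcond big_seq [RHS]big_seq; apply: eq_bigr => x xf.
  rewrite coefCM coefXnM.
  case: (boolP (same_content x x0)) => [cx|cx] /=.
    have cx1 : same_content x1 x by rewrite /same_content (permPl c1) perm_sym.
    rewrite /weight (perm_word_weight N cx1) ltnn subnn.
    case: (boolP (below m x)) => [bx|bx].
      by rewrite (act_same_content cx1 b1 am' bx) /= eqxx coef1 mulr1.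
    by rewrite /act /bicyclic_act -/(below m x) (negbTE bx) /= coef0 mulr0.
  case: ltnP => wx; first by rewrite mulr0.
  case: (act x m) => [s|] /=; last by rewrite coef0 mulr0.
  case: eqP => _; last by rewrite coef0 mulr0.
  rewrite coef1 subn_eq0; case: leqP => [wx'|_]; last by rewrite mulr0.
  case/negP: cx; rewrite /same_content -(permPr c1).
  apply: (word_weight_inj (sizeN _ xf) (sizeN _ x1f)).
  by apply/eqP; rewrite eqn_leq wx.
(* Evaluation at [m] is an eigenvector of [g * f] with eigenvalue $X^cp$. *)
have gf k : row_act N k (g * f) m = 'X^c * p * k m.
  rewrite row_actM // row_actE /p row_actE mulr_sumr mulr_suml; apply: eq_bigr => x _.
  have -> : oapp (row_act N k g) 0 (act x m) =
      'X^c * oapp (fun s => if s == m' then 1 else 0) 0 (act x m) * k m.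
    case: (act x m) => [s|] /=; last by rewrite mulr0 mul0r.
    by rewrite hg; case: eqP => _; rewrite ?mulr1 // !mulr0 mul0r.
  by rewrite !mulrA; congr (_ * _ * _); rewrite -[RHS]mulrA mulrC.
have [r hr] := jacobson_left_inverse g jf.
have := congr1 (fun h => row_act N (fun=> 1) h m) hr.
rewrite /= row_actM // row_actB row_act1 // row_act1 // gf => e.
have p0 : p != 0 by apply: contraNneq pE => ->; rewrite coef0.
(* A divisor of 1 in $K[X]$ has size 1, whereas $1-X^cp$ is nonconstant because $c>0$ and $p\ne
   0$. *)
have /eqP := congr1 (fun q : {poly K} => size q) e.
rewrite -[X in X - _]mul1r -mulrBl size_poly1 size_mul_eq1 => /andP[/eqP].
have sp : size ('X^c * p) = (c + size p)%N by rewrite mulrC size_mulXn.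
have p_gt0 : (0 < size p)%N by rewrite size_poly_gt0.
by rewrite addrC size_polyDl size_polyN sp ?size_poly1; lia.
Qed.
End JacobsonRadical.

(** * From vanishing fiber sums to membership in the binomial ideal *)

Section FiberSums.
Local Open Scope ring_scope.
Variables (K : fieldType) (n : nat) (A : {set 'I_n * 'I_n}).
Hypothesis A_pairs : A \subset index_pairs n.
Local Notation M := (chinese_monoid n).
Local Notation R := {malg K[M]}.
Local Notation I := {a : 'I_n * 'I_n | a \in A}.
Local Notation state := {ffun I -> nat}.
Implicit Types (x y : M) (f g : R) (m : state) (a b : I).

Lemma agree_refl x : agree A x x.
Proof. by []. Qed.

Lemma agree_sym x y : agree A x y -> agree A y x.
Proof. by move=> [p e]; split; [rewrite perm_sym | move=> a aA; rewrite e]. Qed.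

Lemma agree_trans y x z : agree A x y -> agree A y z -> agree A x z.
Proof.
by move=> [p e] [q h]; split; [exact: perm_trans p q | move=> a aA; rewrite e // h].
Qed.

(* Fiber sums are iterated differences of downward closed sums: prescribe the
   coordinates exactly one after the other. *)
Lemma fiber_sum_eq0 f x0 :
  (forall m, \sum_(x <- msupp f | same_content x x0 && below m x) f@_x = 0) ->
  \sum_(x <- msupp f | `[< agree A x0 x >]) f@_x = 0.
Proof.
move=> sum0.
pose at_ (l : seq I) m x := all (fun a => (bicyclic_image (val a) x).2 == m a) l.
have exact0 (l : seq I) m : uniq l -> \sum_(x <- msupp f |
    [&& same_content x x0, below m x & at_ l m x]) f@_x = 0.
  elim: l m => [|a l IH] m.
    by move=> _; rewrite -[RHS](sum0 m); apply: eq_bigl => x; rewrite andbT.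
  move=> /= /andP[al ul]; have := IH m ul.
  rewrite (bigID (fun x => (bicyclic_image (val a) x).2 == m a)) /=.
  rewrite [X in _ + X = _](_ : _ = 0) ?addr0 => [e|].
    rewrite -[RHS]e; apply: eq_bigl => x; rewrite -!andbA; do 2!congr andb; exact: andbC.
  (* The complementary terms are those below the state with coordinate [a] lowered by one; there are
     none if [m a] is zero. *)
  case ma : (m a) => [|d].
    rewrite big1 // => x /andP[/and3P[_ /forallP/(_ a) + _]].
    by rewrite ma leqn0 => ->.
  pose m1 : state := [ffun b => if b == a then d else m b].
  rewrite -[RHS](IH m1 ul); apply: eq_bigl => x; rewrite -!andbA; congr andb.
  have -> : at_ l m1 x = at_ l m x.
    apply: eq_in_all => b bl; rewrite ffunE; case: (b =P a) => // ba.
    by rewrite -ba bl in al.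
  rewrite andbCA [RHS]andbC; congr andb.
  apply/andP/forallP => [[/forallP h xa] b|h].
    rewrite ffunE; case: eqP => [->|_]; last exact: h.
    by rewrite -ltnS ltn_neqAle xa -ma; exact: h.
  split; last by have := h a; rewrite ffunE eqxx; case: eqP => // ->; rewrite ltnn.
  apply/forallP => b; have := h b; rewrite ffunE; case: eqP => [->|//].
  by rewrite ma => /leqW.
pose m0 : state := [ffun a => (bicyclic_image (val a) x0).2].
rewrite -[RHS](exact0 (enum {: I}) m0 (enum_uniq _)); apply: eq_bigl => x.
apply/asboolP/and3P => [[p e]|[p _ /allP h]].
  have e2 a : (bicyclic_image (val a) x).2 = m0 a by rewrite ffunE e //; exact: valP.
  split; first by rewrite /same_content perm_sym.
    by apply/forallP => a; rewrite e2.
  by apply/allP => a _; rewrite e2.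
split=> [|a aA]; first by rewrite perm_sym.
have la : (a.1 < a.2)%N by have /fintype.subsetP/(_ a aA) := A_pairs; rewrite inE.
have /eqP := h (Sub a aA) (mem_enum _ _); rewrite ffunE SubK => e2.
(* Only exponents of $q$ were prescribed; equal content yields those of $p$. *)
have := bicyclic_image_balance la p; rewrite e2 => /addIn e1.
by rewrite [LHS]surjective_pairing -e1 -e2 -surjective_pairing.
Qed.
(** Replacing each support element by a representative of its class changes [f] by binomials, and
    the result is zero because its coefficients are the fiber sums. *)
Lemma binomial_span_fibers f :
  (forall x0, \sum_(x <- msupp f | `[< agree A x0 x >]) f@_x = 0) ->
  binomial_span (agree A) f.
Proof.
move=> f0; pose rep x : M := choose (fun y => `[< agree A x y >]) x.
have repP x : agree A x (rep x).
  by apply/asboolP/(@chooseP _ (fun y => `[< agree A x y >])); exact/asboolP/agree_refl.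
have rep_eq x y : agree A x y -> rep x = rep y.
  move=> xy; rewrite /rep (@eq_choose _ _ (fun z => `[< agree A y z >])).
    by apply: choose_id; apply/asboolP => //; exact: agree_sym.
  move=> z; apply/asboolP/asboolP; last exact: agree_trans.
  exact/agree_trans/agree_sym.
have <- : \sum_(x <- msupp f) (<< f@_x *g x >> - << f@_x *g rep x >>) = f.
  rewrite sumrB -monalgE [X in _ - X](_ : _ = 0) ?subr0 //.
  apply/malgP => y; rewrite mcoeff0 raddf_sum /=.
  under eq_bigr do rewrite mcoeffU mulrb.
  rewrite -big_mkcond /=; have [yy|yy] := eqVneq (rep y) y; last first.
    apply: big1 => x /eqP xy; case/eqP: yy; rewrite -[RHS]xy; apply/esym/rep_eq.
    by rewrite -xy.
  rewrite -[RHS](f0 y); apply: eq_bigl => x; apply/eqP/asboolP => [<-|/rep_eq <-] //.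
  exact/agree_sym.
by apply: binomial_span_sum => x _; exact: binomial_span1.
Qed.

End FiberSums.

Lemma jacobson_sub_binomial_span (K : fieldType) n (A : {set 'I_n * 'I_n})
    (f : {malg K[chinese_monoid n]}) :
  0 < n -> A \subset index_pairs n -> antichain A ->
  jacobson_radical _ f -> binomial_span (agree A) f.
Proof.
move=> n0 hA anti jf; apply: binomial_span_fibers => x0.
by apply: fiber_sum_eq0 => // m; exact: jacobson_below_sum.
Qed.

Theorem corollary3p1p2 (K : fieldType) (n : nat) (hn : (1 <= n)%N) :
  prime_radical {malg K[chinese_monoid n]} =
  jacobson_radical {malg K[chinese_monoid n]}.
Proof.
apply/seteqP; split=> [|f jf P hP]; first exact: prime_radical_sub_jacobson.
have [A [hA anti AP]] := prime_ideal_antichain hP.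
exact/AP/jacobson_sub_binomial_span.
Qed.
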